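(* Let $H=(V,E)$ be a minimal strict implication hypergraph with vertices $V=\{p_1,\ldots,p_n\}$ and adjacency matrix $A$, and let $\nu,\epsilon>0$. If for all $k\in\{1,\ldots,n\}$ the diagonal of $A^k$ is zero, i.e. $\operatorname{diag}(A^k)=\mathbf{0}$, then $H$ is configured.
   Context: A directed hypergraph $H=(V,E)$ has vertex set $V$ and hyperedges $e=(T,H)$ with $T,H\subseteq V$; $t(e)=T$ is the tail and $h(e)=H$ the head. An implication hypergraph is a directed hypergraph whose vertices are logical propositions and in which a hyperedge $(T,H)$ represents $\bigwedge_{P\in T}P\implies\bigwedge_{Q\in H}Q$. A vertex $u$ is a descendant of $v$ if it can be reached from $v$ by following hyperedges from tail to head. It is strict if for all $v,w\in V$, $(\{v\},\{w\})\in E$ implies $(\{w\},\{v\})\notin E$. It is minimal if (i) $(\{v\},\{v\})\notin E$ for all $v$; (ii) if $u$ is a descendant of $v$ but not an immediate neighbor of $v$, then $(\{v\},\{u\})\notin E$; (iii) if $(T,H)\in E$ then $(T',H)\notin E$ for every $T'\supsetneq T$. A leaf node is a vertex lying in the tail of no hyperedge; $L(H)$ denotes the set of leaf nodes. The adjacency matrix $A$ is the $n\times n$ matrix with $A_{ij}=\sum_{e\in E,\ p_i\in t(e)}\frac{1}{|t(e)|}\mathbf{1}_{p_j\in h(e)}$. The propositional information $\mathcal{I}_{\nu,\epsilon}(p_i)$ is defined implicitly by the system: $\mathcal{I}_{\nu,\epsilon}(p_i)=\sum_{j=1}^n A_{ij}(\mathcal{I}_{\nu,\epsilon}(p_j)+\epsilon)$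 if $p_i\notin L(H)$, and $\mathcal{I}_{\nu,\epsilon}(p_i)=\nu$ if $p_i\in L(H)$. $H$ is called configured (for the given $\nu,\epsilon$) if this system has a solution with $\mathcal{I}_{\nu,\epsilon}(p_i)>0$ for all $i\in\{1,\ldots,n\}$.
   Formalization: Every hyperedge is required to have a nonempty head; without this the claim fails, e.g. for n = 1 and E = {({p_1}, ∅)}, where p_1 is not a leaf, A = 0, and the system forces the information of p_1 to be 0. *)

(* Defs.v *)
From HB Require Import structures.
From mathcomp Require Import all_boot all_order all_algebra.
Set Implicit Arguments.
Unset Strict Implicit.
Unset Printing Implicit Defensive.
Import Order.TTheory GRing.Theory Num.Theory.
Local Open Scope ring_scope.

(* The vertices p_1, ..., p_n are the elements of 'I_n, and a hyperedge
   (T, H) is the pair of its tail and its head. *)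
Definition hyperedge (n : nat) : Type := ({set 'I_n} * {set 'I_n})%type.

Definition tail n (e : hyperedge n) : {set 'I_n} := e.1.
Definition head n (e : hyperedge n) : {set 'I_n} := e.2.

(* Heads are nonempty: a vertex lying only in tails of hyperedges (T, set0)
   would be neither a leaf nor the source of any nonzero entry of the
   adjacency matrix, and so would carry information 0.  Tails may be empty. *)
Record directed_hypergraph (n : nat) := DirectedHypergraph {
  hyperedges : {set {set 'I_n} * {set 'I_n}};
  head_neq0 : forall e, e \in hyperedges -> head e != set0
}.

Record implication_hypergraph (n : nat) := ImplicationHypergraph {
  hypergraph_of :> directed_hypergraph n;
  proposition : 'I_n -> Prop
}.

(* The implication is what the hyperedge stands for; it is not required to
   hold. *)
Definition represented_implication n (H : implication_hypergraph n)
    (e : hyperedge n) : Prop :=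
  (forall i, i \in tail e -> proposition H i) ->
  (forall j, j \in head e -> proposition H j).

Section Structure.
Variable n : nat.
Implicit Types (E : {set {set 'I_n} * {set 'I_n}}) (H : directed_hypergraph n).

Definition immediate_neighbor E (v u : 'I_n) : bool :=
  [exists e in E, (v \in tail e) && (u \in head e)].

(* Reachability in at least one step. *)
Definition descendant E (v u : 'I_n) : bool :=
  [exists w, immediate_neighbor E v w && connect (immediate_neighbor E) w u].

Definition strict H : Prop :=
  forall v w : 'I_n, ([set v], [set w]) \in hyperedges H ->
    ([set w], [set v]) \notin hyperedges H.

(* In the second clause, being a descendant and being an immediate neighbor
   are tested without the hyperedge ({v}, {u}) itself: if that hyperedge were
   kept, its presence would make u an immediate neighbor of v and the clause
   would hold for every hypergraph.  It says that ({v}, {u}) is not a shortcut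
   for a longer route from v to u. *)
Definition minimal H : Prop :=
  let E := hyperedges H in
  [/\ forall v : 'I_n, ([set v], [set v]) \notin E,
      forall v u : 'I_n,
        descendant (E :\ ([set v], [set u])) v u ->
        ~~ immediate_neighbor (E :\ ([set v], [set u])) v u ->
        ([set v], [set u]) \notin E
    & forall T K : {set 'I_n}, (T, K) \in E ->
        forall T' : {set 'I_n}, T \proper T' -> (T', K) \notin E].

Definition leaves H : {set 'I_n} :=
  [set v | [forall e in hyperedges H, v \notin tail e]].

Definition adjacency (R : realFieldType) H : 'M[R]_n :=
  \matrix_(i, j) \sum_(e in hyperedges H | i \in tail e)
    (#|tail e|%:R)^-1 * (j \in head e)%:R.

Definition is_propositional_information (R : realFieldType) H (nu eps : R)
    (I : 'I_n -> R) : Prop :=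
  forall i : 'I_n,
    (i \notin leaves H -> I i = \sum_j adjacency R H i j * (I j + eps)) /\
    (i \in leaves H -> I i = nu).

Definition configured (R : realFieldType) H (nu eps : R) : Prop :=
  exists I : 'I_n -> R,
    is_propositional_information H nu eps I /\ forall i, 0 < I i.

End Structure.

(* Main.v *)
Require Import Defs.
From mathcomp Require Import all_boot all_order all_algebra.
Import Order.TTheory GRing.Theory Num.Theory.
Local Open Scope ring_scope.

(** If every diagonal entry of [A ^+ k] vanishes for [1 <= k <= n], then the
    graph of the nonzero entries of the nonnegative matrix [A] has no cycle,
    because a simple cycle of length [k] contributes a positive term to a
    diagonal entry of [A ^+ k].  The number of vertices reachable from [i] then
    strictly decreases along edges, so iterating the defining system [n + 1]
    times from the constant vector [nu] reaches a fixed point.  Positivity is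
    preserved at each step since a vertex that is not a leaf has an edge. *)

Section NonnegativeMatrix.
Variables (R : realFieldType) (n : nat) (A : 'M[R]_n).
Hypothesis A_ge0 : forall i j, 0 <= A i j.

Let arc : rel 'I_n := fun i j => 0 < A i j.

Lemma exprmx_ge0 k i j : 0 <= (A ^+ k) i j.
Proof.
elim: k i j => [|k IHk] i j; first by rewrite expr0 mxE ler0n.
by rewrite exprS mxE sumr_ge0 // => l _; rewrite mulr_ge0.
Qed.

(** An entry of [A ^+ k] sums the weights of all walks of length [k]; the given one weighs a
    positive amount and no other can cancel it. *)
Lemma exprmx_path_gt0 i p : path arc i p -> 0 < (A ^+ size p) i (last i p).
Proof.
elim: p i => [|j p IHp] i /=; first by rewrite expr0 mxE eqxx ltr01.
case/andP=> arc_ij /IHp jp_gt0; rewrite exprS mxE (bigD1 j) //=.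
by rewrite ltr_pwDl ?mulr_gt0 // sumr_ge0 // => l _; rewrite mulr_ge0 ?exprmx_ge0.
Qed.

Hypothesis diag0 : forall k, (1 <= k <= n)%N -> forall i, (A ^+ k) i i = 0.

Lemma arc_acyclic i j : arc i j -> ~~ connect arc j i.
Proof.
move=> arc_ij; apply/connectP => -[p0 p0P def_i].
(* Removing repeated vertices keeps the length of the closed cycle within the range of [diag0]. *)
case/shortenP: p0P def_i => p jp_path jp_uniq _ def_i.
have cycle_le_n : (size (j :: p) <= n)%N.
  by rewrite -(card_uniqP jp_uniq) -[X in (_ <= X)%N]card_ord max_card.
have /exprmx_path_gt0 : path arc i (j :: p) by rewrite /= arc_ij.
by rewrite /= -def_i diag0 // ltxx.
Qed.

Lemma arc_card_connect i j :
  arc i j -> (#|connect arc j| < #|connect arc i|)%N.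
Proof.
move=> arc_ij; apply/proper_card/properP; split.
  by apply/subsetP => k; apply: connect_trans; apply: connect1.
(* [i] reaches itself, but [j] cannot lead back to it. *)
by exists i; [exact: connect0 | exact: arc_acyclic].
Qed.

End NonnegativeMatrix.

Section InformationIteration.
Variables (R : realFieldType) (n : nat) (A : 'M[R]_n).
Variables (L : {set 'I_n}) (nu eps : R).
Hypothesis A_ge0 : forall i j, 0 <= A i j.

Definition information_step (I : 'I_n -> R) (i : 'I_n) : R :=
  if i \in L then nu else \sum_j A i j * (I j + eps).

Let info k : 'I_n -> R := iter k information_step (fun=> nu).

(** Values settle in order of rank [r]: a term with [A i j = 0] vanishes whatever the value at [j],
    and any other [j] has smaller rank, so it settled one step earlier. *)
Lemma info_stable (r : 'I_n -> nat) :
    (forall i j, 0 < A i j -> (r j < r i)%N) ->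
  forall k i, (r i < k)%N -> info k.+1 i = info k i.
Proof.
move=> r_decr; elim=> [//|k IHk] i lt_rik.
change (information_step (info k.+1) i = information_step (info k) i).
rewrite /information_step.
case: ifP => // _; apply: eq_bigr => j _.
have := A_ge0 i j; rewrite le0r => /orP[/eqP-> | /r_decr lt_rji].
  by rewrite !mul0r.
by rewrite IHk // (leq_trans lt_rji).
Qed.

Lemma info_gt0 : 0 < nu -> 0 < eps ->
    (forall i, i \notin L -> exists j, 0 < A i j) ->
  forall k i, 0 < info k i.
Proof.
move=> nu_gt0 eps_gt0 exA; elim=> [//|k IHk] i.
change (0 < information_step (info k) i); rewrite /information_step.
case: ifPn => // /exA[j Aij].
have I_gt0 l : 0 < info k l + eps by rewrite addr_gt0.
rewrite (bigD1 j) //= ltr_pwDl ?mulr_gt0 // sumr_ge0 // => l _.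
by rewrite mulr_ge0 // ltW.
Qed.

End InformationIteration.

Arguments information_step {R n}.

Section Adjacency.
Variables (R : realFieldType) (n : nat) (H : directed_hypergraph n).

Lemma adjacency_ge0 i j : 0 <= adjacency R H i j.
Proof.
by rewrite mxE sumr_ge0 // => e _; rewrite mulr_ge0 ?invr_ge0 ?ler0n.
Qed.

Lemma adjacency_gt0 e i j :
    e \in hyperedges H -> i \in tail e -> j \in Defs.head e ->
  0 < adjacency R H i j.
Proof.
move=> eH it jh; rewrite mxE (bigD1 e) /= ?eH ?it //.
rewrite ltr_pwDl ?sumr_ge0 // => [|f _]; last first.
  by rewrite mulr_ge0 ?invr_ge0 ?ler0n.
(* Since [i] lies in the tail, its cardinal is nonzero and the inverse is not the default
   [0^-1 = 0]. *)
by rewrite jh mulr1 invr_gt0 ltr0n; apply/card_gt0P; exists i.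
Qed.

(** Nonempty heads enter here: they supply the target [j]. *)
Lemma nonleaf_adjacency i :
  i \notin leaves H -> exists j, 0 < adjacency R H i j.
Proof.
rewrite inE negb_forall => /existsP[e]; rewrite negb_imply negbK.
case/andP=> eH it; have /set0Pn[j jh] := head_neq0 eH.
by exists j; apply: adjacency_gt0 eH it jh.
Qed.

End Adjacency.

Theorem theorem2 (R : realFieldType) (n : nat) (H : implication_hypergraph n)
    (nu eps : R) (Hminimal : minimal H) (Hstrict : strict H)
    (nu_gt0 : 0 < nu) (eps_gt0 : 0 < eps)
    (Hdiag : forall k : nat, (1 <= k <= n)%N ->
       forall i : 'I_n, (adjacency R H ^+ k) i i = 0) :
  configured H nu eps.
Proof.
have A_ge0 := @adjacency_ge0 R n H.
pose I := iter n.+1 (information_step (adjacency R H) (leaves H) nu eps)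
  (fun=> nu).
exists I; split=> [i|]; last first.
  by apply: info_gt0 => // i; apply: nonleaf_adjacency.
have stable : information_step (adjacency R H) (leaves H) nu eps I i = I i.
  have r_decr := arc_card_connect _ _ _ A_ge0 Hdiag.
  apply: (info_stable _ _ _ _ _ _ A_ge0 _ r_decr n.+1).
  (* The rank of [i] counts the vertices reachable from it, [i] included, so it can equal [n]; hence
     [n.+1] iterations. *)
  by rewrite ltnS -[X in (_ <= X)%N]card_ord max_card.
by split=> iL; rewrite -{1}stable /information_step ?iL ?(negPf iL).
Qed.
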